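(* There is an absolute constant $C>0$ such that the following holds. Let $G$ be a graph with $n$ vertices and average degree $d\ge 2$. Then $$f(G)\ge \frac{d}{2^{C\sqrt{\log d\,\log\log n}}},$$ i.e. $f(G)\ge d/2^{O(\sqrt{\log d\log\log n})}$.
   Context: An edge-ordering of a graph $G$ is a total order $\le_G$ on $E(G)$. A path is monotone if its consecutive edges form a monotone sequence with respect to $\le_G$. The altitude $f(G)$ is the maximum $k$ such that every edge-ordering of $G$ contains a monotone path of length $k$ (length = number of edges). All logarithms are base 2. *)

(* Defs.v *)
From mathcomp Require Import all_boot.
From Stdlib Require Import Reals.
Set Implicit Arguments. Unset Strict Implicit. Unset Printing Implicit Defensive.

Section Graphs.
Variable T : finType.
Variable e : rel T.

Definition simple_graph := symmetric e /\ irreflexive e.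

Definition edges : {set {set T}} :=
  [set [set x; y] | x in T, y in T & e x y].

(* An edge-ordering is a total order on E(G); since E(G) is finite we
   represent it by an injective ranking of the edges into 'I_|E(G)|
   (values outside E(G) are irrelevant).  Every total order on E(G) arises
   this way, and the induced order is  s <= t  iff  o s <= o t. *)
Definition edge_ordering (o : {ffun {set T} -> 'I_#|edges|}) : bool :=
  [forall s in edges, forall t in edges, (o s == o t) ==> (s == t)].

Definition monotone_path (o : {ffun {set T} -> 'I_#|edges|}) (x : T) (s : seq T)
  : bool :=
  let r := pairmap (fun a b => nat_of_ord (o [set a; b])) x s in
  [&& path e x s, uniq (x :: s) & sorted ltn r || sorted (fun a b => ltn b a) r].

Definition has_monotone_path (o : {ffun {set T} -> 'I_#|edges|}) (k : nat) : bool :=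
  [exists x : T, exists s : k.-tuple T, monotone_path o x s].

Definition forced_length (k : nat) : bool :=
  [forall o : {ffun {set T} -> 'I_#|edges|}, edge_ordering o ==> has_monotone_path o k].

(* the altitude f(G): the maximum such k (paths have length < #|T|) *)
Definition altitude : nat := \max_(k < #|T| | forced_length k) k.

Definition avg_degree : R := (2 * INR #|edges| / INR #|T|)%R.

End Graphs.

Definition log2 (x : R) : R := (ln x / ln 2)%R.

(* Main.v *)
(* Peel the graph: level h.+1 is obtained from level h by deleting the largest
   edge at every vertex.  This removes at most n edges, and an edge of level h
   sees, at each endpoint, h larger edges, one leaving in each lower level.
   Suppose every edge of level h starts an increasing path of length k avoiding
   any prescribed O(log n) vertices.  Starting from an edge uv, explore the
   vertices reachable by increasing paths avoiding the vertices used so far,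
   each step descending through a band of D levels.  Within log n steps the
   reached set X stops doubling; then the band edges of X span a dense graph on
   the next reached set, so some edge xy of it has level h inside this graph.
   A short path from v to x, which the path of length k started by xy is told to
   avoid, followed by that path, gives one segment.  Here D only has to exceed
   the number of used vertices plus O(h), so m segments can be concatenated at
   the cost of m log n bands.  Iterating t times gives increasing paths of
   length m^t once the average degree exceeds (C m log n)^(t+1); finally take
   m = 2^r with r close to sqrt (log d loglog n). *)
Require Import Defs.
From mathcomp Require Import all_boot.
From mathcomp Require Import zify.
Set Implicit Arguments. Unset Strict Implicit. Unset Printing Implicit Defensive.

(** * Increasing walks and peeling levels *)

Section OrderedGraphs.
Variables (T : finType) (o : T -> T -> nat).
Hypothesis osym : forall x y, o x y = o y x.
Implicit Types (g : rel T) (x y u v w : T) (s q : seq T) (S A : {set T}).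

(** Distinct labels are asked only of edges sharing a vertex, as consecutive edges of a walk do;
    subgraphs inherit this. *)
Definition locally_injective g :=
  forall x y z, g x y -> g x z -> o x y = o x z -> y = z.

Definition top g x y := g x y && [forall z, g x z ==> (o x z <= o x y)].

Definition peel g : rel T := fun x y => [&& g x y, ~~ top g x y & ~~ top g y x].

Definition level g h : rel T := iter h peel g.

(* The continuation [s] of a walk whose last edge so far is [uv]. *)
Fixpoint increasing g u v s :=
  if s is w :: s' then [&& g v w, o u v < o v w & increasing g v w s'] else true.

(* The last edge of the walk [u, v, s] is [(prelast u v s, last v s)]. *)
Definition prelast u v s := last u (belast v s).

Definition npairs g := #|[set p : T * T | g p.1 p.2]|.

Lemma increasing_cat g u v s1 s2 :
  increasing g u v (s1 ++ s2) =
  increasing g u v s1 && increasing g (prelast u v s1) (last v s1) s2.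
Proof. by elim: s1 u v => //= w s IH u v; rewrite IH !andbA. Qed.

Lemma prelast_cat u v s1 s2 :
  prelast u v (s1 ++ s2) = prelast (prelast u v s1) (last v s1) s2.
Proof. by elim: s1 u v => //= w s IH u v; rewrite -[LHS]/(prelast v w (s ++ s2)) IH. Qed.

Lemma increasing_sub g g' u v s :
  subrel g g' -> increasing g u v s -> increasing g' u v s.
Proof.
move=> sub; elim: s u v => //= w s IH u v /and3P[gvw -> /IH ->].
by rewrite sub.
Qed.

Lemma increasing_last g u v s :
  g u v -> increasing g u v s -> g (prelast u v s) (last v s).
Proof. by elim: s u v => //= w s IH u v _ /and3P[gvw _ /IH]; apply. Qed.

Lemma increasing_in g A u v s :
  (forall x y, g x y -> y \in A) -> increasing g u v s -> all (mem A) s.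
Proof.
by move=> gA; elim: s u v => //= w s IH u v /and3P[/gA -> _ /IH].
Qed.

Lemma peel_sub g : subrel (peel g) g.
Proof. by move=> x y /and3P[]. Qed.

Lemma level_sub g a b : a <= b -> subrel (level g b) (level g a).
Proof.
move=> /subnK <-; elim: (b - a) => // k IH x y /peel_sub; exact: IH.
Qed.

Lemma level_sym g h : symmetric g -> symmetric (level g h).
Proof.
move=> gs; elim: h => // h IH x y; rewrite /= /peel -/(level g h) IH.
by rewrite [~~ _ && _]andbC.
Qed.

Lemma level_inj g h : locally_injective g -> locally_injective (level g h).
Proof. by move=> gi x y z /(level_sub (leq0n h)) xy /(level_sub (leq0n h)); apply: gi. Qed.

Lemma top_inj g x y z : locally_injective g -> top g x y -> top g x z -> y = z.
Proof.
move=> gi /andP[xy /forallP ty] /andP[xz /forallP tz].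
apply: (gi x) => //; apply/eqP; rewrite eqn_leq.
by rewrite (implyP (tz y)) // (implyP (ty z)).
Qed.

Lemma top_level_out g h x y : top (level g h) x y -> ~~ level g h.+1 x y.
Proof. by move=> t; rewrite /= /peel -/(level g h) t /= andbF. Qed.

Lemma top_exists g x y : g x y -> exists z, top g x z.
Proof.
move=> xy; case: (arg_maxnP (o x) xy) => z xz zmax; exists z.
by rewrite /top xz; apply/forallP => w; apply/implyP; apply: zmax.
Qed.

(** * Bands of top edges, and the loss under peeling *)

Definition band g a b x : {set T} :=
  [set y | [exists j : 'I_b, (a <= j) && top (level g j) x y]].

Lemma bandP g a b x y :
  reflect (exists j, [/\ a <= j, j < b & top (level g j) x y]) (y \in band g a b x).
Proof.
rewrite inE; apply: (iffP existsP) => [[j /andP[aj t]]|[j [aj jb t]]].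
  by exists j.
by exists (Ordinal jb); rewrite aj.
Qed.

(** The edge [uv] survives to level [b], so [v] has a top neighbour in each level from [a] to
    [b - 1]; these differ, since a top edge is absent from the next level. *)
Lemma card_band g a b u v :
  symmetric g -> level g b u v -> b - a <= #|band g a b v|.
Proof.
move=> gs; elim: b => [|b IH] uv //.
have [ab|ba] := leqP a b; last by lia.
have uvb := level_sub (leqnSn b) uv.
have [y ty] : exists y, top (level g b) v y.
  by apply: (@top_exists _ _ u); rewrite level_sym.
have yb : y \notin band g a b v.
  apply/bandP => -[j [_ jb /top_level_out /negP[]]].
  by case/andP: ty => yv _; apply: level_sub yv.
have sub : y |: band g a b v \subset band g a b.+1 v.
  apply/subsetP => z /setU1P[->|/bandP[j [aj jb tj]]]; apply/bandP.
    by exists b.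
  by exists j; split=> //; apply: ltnW.
have := subset_leq_card sub; rewrite cardsU1 yb; have := IH uvb; lia.
Qed.

(** [uv] outlives level [j], so it is in that level without being the top edge at [v]; local
    injectivity excludes a tie. *)
Lemma band_gt g a b u v w :
  symmetric g -> locally_injective g ->
  level g b u v -> w \in band g a b v -> o u v < o v w.
Proof.
move=> gs gi uv /bandP[j [aj jb tw]].
have vu : level g j.+1 v u by rewrite level_sym //; apply: level_sub uv.
have vuj := level_sub (leqnSn j) vu.
case/andP: (tw) => vw /forallP/(_ u)/implyP/(_ vuj).
rewrite (osym u v) leq_eqVlt => /orP[/eqP eq|//].
have uw := level_inj gi vuj vw eq.
by have := top_level_out tw; rewrite -uw vu.
Qed.

Lemma band_level g a b v w : w \in band g a b v -> level g a v w.
Proof. by move=> /bandP[j [aj _ /andP[vw _]]]; apply: level_sub vw. Qed.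

(** Each vertex starts at most one top pair, and a deleted pair or its reversal is a top pair. *)
Lemma npairs_peel g A :
  symmetric g -> locally_injective g -> (forall x y, g x y -> x \in A) ->
  npairs g <= npairs (peel g) + 2 * #|A|.
Proof.
move=> gs gi gA.
pose t1 := [set p : T * T | top g p.1 p.2].
pose t2 := [set (p.2, p.1) | p : T * T in t1].
have ct1 : #|t1| <= #|A|.
  rewrite -(@card_in_imset _ _ fst t1) => [|p q].
    apply/subset_leq_card/subsetP => x /imsetP[p]; rewrite inE => /andP[gp _] ->.
    exact: gA gp.
  rewrite !inE; case: p => a b; case: q => c d /= tp tq eq.
  by rewrite -eq in tq *; rewrite (top_inj gi tp tq).
have ct2 : #|t2| <= #|A| by apply: leq_trans ct1; apply: leq_imset_card.
have sub : [set p : T * T | g p.1 p.2]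
    \subset [set p : T * T | peel g p.1 p.2] :|: (t1 :|: t2).
  apply/subsetP => -[x y]; rewrite !inE /= /peel => ->/=.
  case txy: (top g x y) => //=.
  case tyx: (top g y x) => //=.
  by apply/imsetP; exists (y, x); rewrite ?inE.
have := subset_leq_card sub.
have := (leq_card_setU [set p : T * T | peel g p.1 p.2] (t1 :|: t2)).1.
have := (leq_card_setU t1 t2).1; rewrite /npairs; lia.
Qed.

Lemma npairs_level g A h :
  symmetric g -> locally_injective g -> (forall x y, g x y -> x \in A) ->
  npairs g <= npairs (level g h) + 2 * h * #|A|.
Proof.
move=> gs gi gA; elim: h => [|h IH]; first by rewrite leq_addr.
have := @npairs_peel (level g h) A (level_sym h gs) (level_inj gi).
move=> /(_ (fun x y xy => gA x y (level_sub (leq0n h) xy))).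
rewrite -[peel (level g h)]/(level g h.+1); nia.
Qed.

Lemma level_nonempty g A h :
  symmetric g -> locally_injective g -> (forall x y, g x y -> x \in A) ->
  2 * h * #|A| < npairs g -> exists x y, level g h x y.
Proof.
move=> gs gi gA lt.
have : 0 < npairs (level g h) by have := npairs_level h gs gi gA; lia.
by case/card_gt0P => -[x y]; rewrite inE /=; exists x, y.
Qed.

(** * Sets reachable through successive bands *)

Section Reach.
Variables (g : rel T) (u v : T) (b D : nat) (S : {set T}).
Hypotheses (gs : symmetric g) (gi : locally_injective g) (uv : level g b u v).

Fixpoint reach i : {set T} :=
  if i is i'.+1 then
    reach i' :|: \bigcup_(x in reach i') (band g (b - i'.+1 * D) (b - i' * D) x :\: S)
  else [set v].

Lemma reach_avoid i : v \notin S -> {in reach i, forall x, x \notin S}.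
Proof.
move=> vS; elim: i => [|i IH] x; first by move=> /set1P ->.
case/setUP => [/IH //|/bigcupP[y _]]; by case/setDP.
Qed.

(** A newly reached vertex extends the path to some [y] in [reach i]: [band_gt] makes the new edge
    larger, and the path stays simple because it lies in [reach i] and the new vertex does not. The
    level of the last edge is recorded so that the next band lies below it. *)
Lemma reachP i x : x \in reach i -> exists q,
  [/\ size q <= i, increasing g u v q, uniq (v :: q), last v q = x
   & [/\ {subset q <= ~: S}, {subset v :: q <= reach i}
       & level g (b - i * D) (prelast u v q) x]].
Proof.
elim: i x => [|i IH] x.
  move=> /set1P ->; exists [::]; split=> //; split=> //.
    by move=> y; rewrite !inE.
  by rewrite subn0.
have [xi _|xi] := boolP (x \in reach i).
  have [q [sq iq uq lq [qS qr lv]]] := IH x xi.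
  exists q; split=> //; first exact: ltnW.
  split=> //; first by move=> y /qr yr; rewrite /= inE yr.
  by apply: level_sub lv; nia.
rewrite /= inE (negPf xi) /= => /bigcupP[y yi /setDP[xb xS]].
have [q [sq iq uq lq [qS qr lv]]] := IH y yi.
exists (rcons q x); split.
- by rewrite size_rcons.
- rewrite -cats1 increasing_cat iq lq /= andbT.
  by rewrite (band_gt gs gi lv xb) andbT; apply: level_sub (leq0n _) _ _ (band_level xb).
- change (is_true (uniq (v :: rcons q x))); rewrite -rcons_cons rcons_uniq uq andbT.
  by apply: contra xi; apply: qr.
- by rewrite last_rcons.
split.
- by move=> z; rewrite mem_rcons inE => /predU1P[->|/qS//]; rewrite inE.
- move=> z; rewrite -rcons_cons mem_rcons inE => /predU1P[->|/qr zr].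
    by rewrite inE; apply/orP; right; apply/bigcupP; exists y; rewrite // in_setD xS.
  by rewrite inE zr.
by rewrite -cats1 prelast_cat lq; apply: band_level xb.
Qed.

(** Otherwise the sets double [L.+1] times from one vertex and outgrow [T]. *)
Lemma reach_stalls L : #|T| < 2 ^ L.+1 ->
  exists2 i, i <= L & #|reach i.+1| <= 2 * #|reach i|.
Proof.
move=> nL.
have [/existsP[i Hi]|/existsPn grow] :=
  boolP [exists i : 'I_L.+1, #|reach i.+1| <= 2 * #|reach i|].
  by exists (i : nat) => //; rewrite -ltnS.
have : forall i, i <= L.+1 -> 2 ^ i <= #|reach i|.
  elim=> [|i IH] iL; first by rewrite cards1.
  have := grow (Ordinal iL); rewrite -ltnNge => lt.
  by rewrite expnS; apply: leq_trans (ltnW lt); rewrite leq_mul2l IH // ltnW.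
move=> /(_ _ (leqnn _)) /leq_trans /(_ (max_card _)); by rewrite leqNgt nL.
Qed.

End Reach.

(* [M] is the number of steps within which reachable sets stop doubling. *)
Definition extendable M k h :=
  forall g, symmetric g -> locally_injective g ->
  forall u v, level g h u v ->
  forall S, #|S| <= M -> v \notin S ->
  exists s, [/\ size s = k, increasing g u v s, uniq (v :: s) & {subset s <= ~: S}].

(** * One round of lengthening: a segment, then a chain of segments *)

Section Step.
Variables (L k h : nat).
Hypothesis nL : #|T| < 2 ^ L.+1.
Hypothesis ext : extendable L.+1 k h.

(** The dense graph [H] lives on a reached set, which is disjoint from [S]. A continuation inside
    [H] thus avoids [S] for free, however large [S] is, and has to be told only to avoid the short
    path to [x]. *)
Lemma segment g u v b D S :
  symmetric g -> locally_injective g -> level g b u v -> v \notin S ->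
  L.+1 * D <= b -> #|S| + L.+1 + 4 * h < D ->
  exists s, [/\ k < size s <= k.+1 + L, increasing g u v s, uniq (v :: s),
    {subset s <= ~: S} & level g (b - L.+1 * D) (prelast u v s) (last v s)].
Proof.
move=> gs gi uv vS Db SD.
pose X := reach g v b D S.
have [i iL stall] := reach_stalls g v b D S nL.
rewrite -/X in stall.
(* One path per reached vertex is fixed beforehand, since [H] depends on it; outside [X i] the empty
   path is a dummy value. *)
have [q_ q_P] : exists q_ : T -> seq T, forall x, x \in X i ->
    [/\ size (q_ x) <= i, increasing g u v (q_ x), uniq (v :: q_ x), last v (q_ x) = x
     & [/\ {subset q_ x <= ~: S}, {subset v :: q_ x <= X i}
         & level g (b - i * D) (prelast u v (q_ x)) x]].
  apply: (@fin_all_exists T (fun=> seq T) (fun x q => x \in X i ->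
    [/\ size q <= i, increasing g u v q, uniq (v :: q), last v q = x
     & [/\ {subset q <= ~: S}, {subset v :: q <= X i}
         & level g (b - i * D) (prelast u v q) x]])) => x.
  have [xi|] := boolP (x \in X i); last by exists [::].
  by have [q Hq] := reachP gs gi uv xi; exists q.
pose B x := band g (b - i.+1 * D) (b - i * D) x :\: S.
(* Discarding the path to [x] lets each remaining [y] extend it. *)
pose N x := B x :\: [set y in v :: q_ x].
pose arc x y := (x \in X i) && (y \in N x).
pose H : rel T := fun x y => arc x y || arc y x.
have arcX x y : arc x y -> y \in X i.+1.
  case/andP => xi /setDP[yB _]; rewrite /X /= inE; apply/orP; right.
  by apply/bigcupP; exists x.
have X_sub x : x \in X i -> x \in X i.+1 by rewrite /X /= inE => ->.
have HX x y : H x y -> y \in X i.+1.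
  by case/orP => [/arcX //|/andP[/X_sub]].
have Hs : symmetric H by move=> x y; rewrite /H orbC.
have arcg x y : arc x y -> level g (b - i.+1 * D) x y.
  by case/andP => _ /setDP[/setDP[/band_level]].
have Hg : subrel H (level g (b - i.+1 * D)).
  by move=> x y /orP[/arcg //|/arcg]; rewrite level_sym.
have Hg0 : subrel H g by move=> x y /Hg /(level_sub (leq0n _)).
have Hi : locally_injective H by move=> x y z /Hg0 xy /Hg0; apply: gi.
have iLD : i.+1 * D <= L.+1 * D by rewrite leq_mul2r ltnS iL orbT.
(* The band has at least [D] vertices; [S] and the at most [L.+1] vertices of the path are lost. *)
have cN x : x \in X i -> 4 * h < #|N x|.
  move=> xi; have [sq _ _ _ [_ _ lv]] := q_P x xi.
  have := card_band (b - i.+1 * D) gs lv.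
  have : #|[set y in v :: q_ x]| <= L.+1.
    by rewrite cardsE; apply: leq_trans (card_size _) _; apply: leq_trans iL.
  have c1 := cardsD (band g (b - i.+1 * D) (b - i * D) x) S.
  have c2 := cardsD (B x) [set y in v :: q_ x].
  have := subset_leq_card (subsetIr (band g (b - i.+1 * D) (b - i * D) x) S).
  have := subset_leq_card (subsetIr (B x) [set y in v :: q_ x]).
  rewrite -/(B x) in c1; rewrite -/(N x) in c2; rewrite c2 c1.
  have := leq_trans iLD Db; lia.
have Xi0 : 0 < #|X i|.
  apply/card_gt0P; exists v; rewrite /X; elim: i {iL stall q_P N arc H arcX X_sub
    HX Hs arcg Hg Hg0 Hi iLD cN B} => [|i IH] /=; rewrite inE //.
  by rewrite IH.
have cH : 4 * h * #|X i| < npairs H.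
  have sub : [set p : T * T | arc p.1 p.2] \subset [set p : T * T | H p.1 p.2].
    by apply/subsetP => p; rewrite !inE /H => ->.
  apply: leq_trans (subset_leq_card sub).
  have -> : #|[set p : T * T | arc p.1 p.2]| = \sum_(x in X i) #|N x|.
    rewrite cardsE -sum1_card (eq_bigl (fun p : T * T => arc p.1 p.2)) //.
    rewrite -(pair_big_dep (mem (X i)) (fun x y => y \in N x) (fun _ _ => 1)) /=.
    by apply: eq_bigr => x _; rewrite sum1_card.
  have : \sum_(x in X i) (4 * h).+1 <= \sum_(x in X i) #|N x|.
    by apply: leq_sum => x /cN.
  rewrite sum_nat_const; nia.
(* By the stall, [4 * h * #|X i|] is at least [2 * h * #|X i.+1|]. Levels are symmetric, so the edge
   found can be oriented as an arc. *)
have [x [y [xy lxy]]] : exists x y, arc x y /\ level H h x y.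
  have [||x [y lxy]] := @level_nonempty H (X i.+1) h Hs Hi.
  - by move=> x y; rewrite Hs; apply: HX.
  - by apply: leq_ltn_trans cH; nia.
  have /orP[axy|ayx] := level_sub (leq0n h) lxy; first by exists x, y.
  by exists y, x; rewrite level_sym.
have Hxy : H x y by rewrite /H xy.
have /andP[xi /setDP[/setDP[yb yS] yq]] := xy.
have [sq iq uq lq [qS qX lv]] := q_P x xi.
have [||s [ss is_ us sS]] := ext Hs Hi lxy (S := [set z in v :: q_ x]) => //.
  by rewrite cardsE; apply: leq_trans (card_size _) _; apply: leq_trans iL.
exists (q_ x ++ y :: s); split.
- by rewrite size_cat /= ss; move: (leq_trans sq iL); clear; lia.
- rewrite increasing_cat iq lq /= (band_gt gs gi lv yb) (Hg0 _ _ Hxy) /=.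
  exact: (increasing_sub Hg0 is_).
- change (is_true (uniq (v :: q_ x ++ y :: s))); rewrite -cat_cons cat_uniq uq us andbT /=.
  rewrite inE in yq; rewrite (negPf yq) /=; apply/hasPn => z /sS.
  by rewrite !inE.
- move=> z; rewrite mem_cat inE => /or3P[/qS //|/eqP ->|zs]; first by rewrite inE.
  have /allP/(_ z zs) zX := increasing_in HX is_.
  by rewrite inE (reach_avoid vS zX).
rewrite prelast_cat last_cat lq.
have := increasing_last (u := x) (v := y) (s := s) Hxy is_.
by move/Hg; apply: level_sub; rewrite leq_sub2l.
Qed.

(** Each of the [m] chained segments costs [L.+1 * D] levels and avoids the earlier ones. At most
    [L.+1 + m * (k.+1 + L)] vertices are ever forbidden, hence the bound on [D]; surplus length is
    cut off. *)
Lemma extendable_step m D :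
  m * (k.+1 + L) + 2 * L.+1 + 4 * h < D ->
  extendable L.+1 (m * k.+1) (m * (L.+1 * D)).
Proof.
move=> DD g gs gi u v uv S SL vS.
have : forall j, j <= m -> exists s,
    [/\ j * k.+1 <= size s <= j * (k.+1 + L), increasing g u v s, uniq (v :: s),
    {subset s <= ~: S} & level g ((m - j) * (L.+1 * D)) (prelast u v s) (last v s)].
  elim=> [|j IH] jm; first by exists [::]; split=> //; rewrite subn0.
  have [s [ss is_ us sS ls]] := IH (ltnW jm).
  (* [belast] leaves out the current end, from which the next segment starts. *)
  pose S' := S :|: [set z in belast v s].
  have lS' : last v s \notin S'.
    rewrite !inE negb_or; apply/andP; split.
      have := mem_last v s; rewrite inE => /predU1P[-> //|/sS].
      by rewrite inE.
    by move: us; rewrite lastI rcons_uniq => /andP[].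
  have cS' : #|S'| <= L.+1 + size s.
    apply: leq_trans (leq_card_setU _ _).1 _; rewrite leq_add //.
    by rewrite cardsE -(size_belast v s) card_size.
  have js : size s <= m * (k.+1 + L).
    case/andP: ss => _ /leq_trans; apply; rewrite leq_mul2r ltnW ?orbT //.
  have [||s' [ss' is' us' s'S ls']] := @segment _ _ _ _ D S' gs gi ls lS'.
  - by rewrite leq_pmull // subn_gt0.
  - lia.
  exists (s ++ s'); split.
  - by rewrite size_cat; move: ss ss'; clear; lia.
  - by rewrite increasing_cat is_ is'.
  - have [ls's' us'2] : last v s \notin s' /\ uniq s' by apply/andP.
    change (is_true (uniq (v :: s ++ s'))); rewrite -cat_cons cat_uniq us us'2 andbT.
    apply/hasPn => z zs'; have := s'S z zs'; rewrite !inE negb_or => /andP[_ zb].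
    change (z \notin v :: s); rewrite lastI mem_rcons inE negb_or zb andbT.
    by apply: contraNneq ls's' => <-.
  - move=> z; rewrite mem_cat => /orP[/sS //|/s'S].
    by rewrite !inE negb_or => /andP[].
  rewrite prelast_cat last_cat; apply: level_sub ls'.
  by rewrite subnS -subn1 mulnBl mul1n.
case/(_ m (leqnn m)) => s [/andP[ss _] is_ us sS _].
exists (take (m * k.+1) s); split.
- by rewrite size_takel.
- by move: is_; rewrite -{1}(cat_take_drop (m * k.+1) s) increasing_cat => /andP[].
- by move: us; rewrite -{1}(cat_take_drop (m * k.+1) s) -cat_cons cat_uniq => /andP[].
by move=> z /mem_take /sS.
Qed.

End Step.

(** * Iterating the round *)

Lemma extendable_weaken M k k' h h' :
  k' <= k -> h <= h' -> extendable M k h -> extendable M k' h'.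
Proof.
move=> kk hh ext g gs gi u v uv S SM vS.
have [s [ss is_ us sS]] := ext g gs gi u v (level_sub hh uv) S SM vS.
exists (take k' s); split.
- by rewrite size_takel // ss.
- by move: is_; rewrite -{1}(cat_take_drop k' s) increasing_cat => /andP[].
- by move: us; rewrite -{1}(cat_take_drop k' s) -cat_cons cat_uniq => /andP[].
by move=> z /mem_take /sS.
Qed.

(** The predecessor fits the step: from [k.+1 = m ^ t] it yields length [m ^ t.+1]. *)
Lemma extendable_pow L m t : #|T| < 2 ^ L.+1 -> 0 < m ->
  extendable L.+1 (m ^ t).-1 ((10 * L.+1 * m) ^ t.+1).
Proof.
move=> nL m0; elim: t => [|t IH].
  by move=> g gs gi u v uv S _ _; exists [::].
have mt : 0 < m ^ t by rewrite expn_gt0 m0.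
have := @extendable_step L _ _ nL IH m _ (leqnn _).
rewrite prednK //; apply: extendable_weaken.
  by rewrite -expnS leq_pred.
rewrite [leqRHS]expnS.
set A := (10 * L.+1 * m) ^ t.+1; set M := L.+1.
have mA : m ^ t * (m * M) <= A.
  rewrite mulnA -expnSr /A -/M -mulnA [M * m]mulnC mulnA expnMn leq_mul //.
    by rewrite leq_exp2r // leq_pmull.
  by rewrite -{1}(expn1 M) leq_pexp2l.
have mM : m * M <= A by apply: leq_trans mA; rewrite leq_pmull.
have M0 : 0 < M by [].
have m1 : m * m ^ t <= A by apply: leq_trans mA; nia.
have M1 : M <= A by apply: leq_trans mM; nia.
(* The summands are at most [2 * A], [2 * A] and [4 * A]; the constant 10 leaves room for the
   successor. *)
suff : (m * (m ^ t + L) + 2 * L.+1 + 4 * A).+1 <= 10 * A.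
  by move=> le; rewrite mulnA [leqLHS]mulnC [m * M]mulnC; nia.
have -> : L = M.-1 by [].
nia.
Qed.

Lemma increasing_path_pow g m t :
  symmetric g -> irreflexive g -> locally_injective g -> 0 < m ->
  2 * (10 * (trunc_log 2 #|T|).+1 * m) ^ t.+1 * #|T| < npairs g ->
  exists u v s, [/\ size (v :: s) = m ^ t, g u v, increasing g u v s & uniq (u :: v :: s)].
Proof.
move=> gs gir gi m0 lt.
set L := trunc_log 2 #|T| in lt.
have nL : #|T| < 2 ^ L.+1 by apply: trunc_log_ltn.
have [||u [v uv]] := @level_nonempty g setT ((10 * L.+1 * m) ^ t.+1) gs gi.
- by [].
- by rewrite cardsT.
have guv := level_sub (leq0n _) uv.
(* Forbidding [u] keeps the walk simple once the edge [uv] is put in front. *)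
have [||s [ss is_ us sS]] := extendable_pow nL m0 gs gi uv (S := [set u]).
- by rewrite cards1.
- by rewrite inE; apply: contraTneq guv => ->; rewrite /level /= gir.
exists u, v, s; split=> //.
  by rewrite /= ss prednK // expn_gt0 m0.
rewrite cons_uniq us andbT inE negb_or; apply/andP; split.
  by apply: contraTneq guv => ->; rewrite /level /= gir.
by apply/negP => /sS; rewrite !inE eqxx.
Qed.

End OrderedGraphs.

(** * From ordered pairs and increasing walks to edges and the altitude *)

Section Altitude.
Variables (T : finType) (e : rel T).
Hypothesis simple : simple_graph e.

Lemma in_edges x y : e x y -> [set x; y] \in edges e.
Proof. by move=> xy; apply/imset2P; exists x y; rewrite ?inE. Qed.

(** Each edge arises from both orders of its ends, distinct by irreflexivity. *)
Lemma npairs_edges : 2 * #|edges e| <= npairs e.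
Proof.
have [es ei] := simple.
rewrite /npairs cardsE -[leqRHS]sum1_card.
rewrite (partition_big (fun p => [set p.1; p.2]) (mem (edges e))) /=; last first.
  by move=> p /in_edges.
rewrite mulnC -sum_nat_const; apply: leq_sum => E /imset2P[x y _].
rewrite inE => /andP[_ xy] ->.
have sub : [set (x, y); (y, x)] \subset
    [pred p | (p \in [pred p | e p.1 p.2]) && ([set p.1; p.2] == [set x; y])].
  apply/subsetP => p; rewrite !inE => /orP[] /eqP -> /=; first by rewrite xy eqxx.
  by rewrite es xy setUC eqxx.
rewrite sum1_card; apply: leq_trans (subset_leq_card sub).
rewrite cards2; case: eqP => // -[xeq _]; by move: xy; rewrite xeq ei.
Qed.

Lemma npairs_le : npairs e <= #|T| * #|T|.-1.
Proof.
have [_ ei] := simple.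
have -> : #|T| * #|T|.-1 = #|[set p : T * T | p.2 \in [set~ p.1]]|.
  rewrite cardsE -sum1_card (eq_bigl (fun p : T * T => p.2 \in [set~ p.1])) //.
  rewrite -(pair_big_dep predT (fun x y => y \in [set~ x]) (fun _ _ => 1)) /=.
  rewrite -sum_nat_const; apply: eq_bigr => x _.
  by rewrite sum1_card cardsC1.
apply: subset_leq_card; apply/subsetP => -[x y]; rewrite !inE /=.
by apply: contraTneq => ->; rewrite ei.
Qed.

Section Ranking.
Variable o : {ffun {set T} -> 'I_#|edges e|}.

Definition rank x y := nat_of_ord (o [set x; y]).

Lemma rank_sym x y : rank x y = rank y x.
Proof. by rewrite /rank setUC. Qed.

Lemma rank_inj : edge_ordering o -> locally_injective rank e.
Proof.
have [_ ei] := simple.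
move=> /forall_inP oi x y z xy xz /ord_inj eq.
have /forall_inP/(_ _ (in_edges xz)) := oi _ (in_edges xy).
rewrite eq eqxx /= => /eqP eqs.
have : y \in [set x; z] by rewrite -eqs !inE eqxx orbT.
rewrite !inE => /orP[/eqP yx|/eqP //].
by move: xy; rewrite yx ei.
Qed.

Lemma increasing_monotone u v s :
  e u v -> increasing rank e u v s -> uniq (u :: v :: s) -> monotone_path o u (v :: s).
Proof.
move=> uv inc us; apply/and3P; split=> //.
  rewrite /= uv /=; elim: s u v {uv us} inc => //= w s IH u v /and3P[-> _ /IH].
  by [].
apply/orP; left; rewrite /=.
elim: s u v {uv us} inc => //= w s IH u v /and3P[_ lt /IH ->].
by rewrite andbT.
Qed.
End Ranking.

Lemma altitude_ge k :
  (forall o : {ffun {set T} -> 'I_#|edges e|}, edge_ordering o -> exists u v s,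
    [/\ size (v :: s) = k, e u v, increasing (rank o) e u v s & uniq (u :: v :: s)]) ->
  (exists x y, e x y) -> k <= altitude e.
Proof.
move=> paths [x [y xy]].
(* The maximum in [altitude] runs over [k < #|T|]; a path for some ordering supplies this bound. *)
pose o0 : {ffun {set T} -> 'I_#|edges e|} := [ffun E => enum_rank_in (in_edges xy) E].
have oo : edge_ordering o0.
  apply/forall_inP => E Ee; apply/forall_inP => F Fe; apply/implyP.
  by rewrite !ffunE => /eqP/(enum_rank_in_inj Ee Fe) ->.
have kT : k < #|T|.
  have [u [v [s [<- _ _ us]]]] := paths _ oo.
  by have := max_card (mem (u :: v :: s)); rewrite (card_uniqP us).
rewrite /altitude (leq_bigmax_cond (Ordinal kT)) //.
apply/forallP => o; apply/implyP => /paths[u [v [s [sk uv inc us]]]].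
apply/existsP; exists u; apply/existsP; exists (Tuple (introT eqP sk)).
exact: increasing_monotone.
Qed.

Lemma altitude_pow m t : 0 < m ->
  (10 * (trunc_log 2 #|T|).+1 * m) ^ t.+1 * #|T| < #|edges e| ->
  m ^ t <= altitude e.
Proof.
have [es ei] := simple; move=> m0 lt; apply: altitude_ge => [o oo|].
  apply: increasing_path_pow => //; first exact: rank_sym.
    exact: rank_inj.
  by apply: leq_trans npairs_edges; rewrite -mulnA ltn_pmul2l.
have : 0 < npairs e by have := npairs_edges; lia.
by case/card_gt0P => -[x y]; rewrite inE => xy; exists x, y.
Qed.

Lemma altitude_gt0 : 0 < #|edges e| -> 0 < altitude e.
Proof.
move=> /card_gt0P[E /imset2P[x y _]]; rewrite inE => /andP[_ xy] _.
have [es ei] := simple; apply: altitude_ge; last by exists x, y.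
move=> o _; exists x, y, [::]; split=> //=; rewrite inE andbT.
by apply: contraTneq xy => ->; rewrite ei.
Qed.

(* [q] is the least exponent satisfying the first bound. *)
Lemma altitude_tradeoff m : 1 < m -> 0 < #|edges e| -> exists q,
  #|edges e| <= (10 * (trunc_log 2 #|T|).+1 * m) ^ q * #|T| /\ m ^ (q - 2) <= altitude e.
Proof.
move=> m1 E0; set B := 10 * _ * m.
have B1 : 1 < B by rewrite /B; lia.
have T0 : 0 < #|T|.
  case/card_gt0P: E0 => E /imset2P[x _ _ _ _]; apply/card_gt0P.
  by exists x.
have ex : exists q, #|edges e| <= B ^ q * #|T|.
  exists #|edges e|; apply: leq_trans (leq_pmulr _ T0).
  by apply/ltnW/ltn_expl.
case: (ex_minnP ex) => q qE qmin; exists q; split=> //.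
(* For [q < 2] the truncated exponent is 0 and one edge suffices; otherwise minimality refutes the
   bound for the exponent one smaller. *)
case: q qE qmin => [|[|q]] qE qmin; [exact: altitude_gt0..|].
rewrite subn2 /=; apply: altitude_pow; first exact: ltnW.
by rewrite ltnNge -/B; apply/negP => /qmin; rewrite ltnn.
Qed.

(** From [2 n <= n (n - 1)]; this keeps loglog n away from 0. *)
Lemma card_gt2_edges : #|T| <= #|edges e| -> 0 < #|T| -> 2 < #|T|.
Proof. have := npairs_edges; have := npairs_le; nia. Qed.

End Altitude.

(** * Real logarithms and the choice of parameters *)

Lemma expn_pow m k : m ^ k = Nat.pow m k.
Proof. by elim: k => // k IH; rewrite expnS IH. Qed.

(* Loaded only here because Reals rebinds [^] on [nat] to [Nat.pow]. *)
From Stdlib Require Import Reals Lra.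

Lemma log2_mult x y : (0 < x -> 0 < y -> log2 (x * y) = log2 x + log2 y)%R.
Proof. by move=> x0 y0; rewrite /log2 ln_mult //; field; have := ln_lt_2; lra. Qed.

Lemma log2_pow x k : (0 < x -> log2 (x ^ k) = INR k * log2 x)%R.
Proof. by move=> x0; rewrite /log2 ln_pow //; field; have := ln_lt_2; lra. Qed.

Lemma log2_le x y : (0 < x -> x <= y -> log2 x <= log2 y)%R.
Proof.
move=> x0 xy; apply: Rmult_le_compat_r; first by have := ln_lt_2; have := Rinv_0_lt_compat (ln 2); lra.
by case: xy => [/(ln_increasing _ _ x0)|->]; [left|right].
Qed.

Lemma log2_2 : log2 2 = 1%R.
Proof. by rewrite /log2; field; have := ln_lt_2; lra. Qed.

Lemma Rpower_log2 x : (0 < x -> Rpower 2 (log2 x) = x)%R.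
Proof.
move=> x0; rewrite /Rpower /log2.
have -> : (ln x / ln 2 * ln 2 = ln x)%R by field; have := ln_lt_2; lra.
exact: exp_ln.
Qed.

(** Rests on [2 ^ 3 <= 3 ^ 2] and [2 <= (3 / 2) ^ 2]. *)
Lemma log2_loglog_ge n : (3 <= n -> 3 / 2 <= log2 n /\ 1 / 2 <= log2 (log2 n))%R.
Proof.
move=> n3.
have l3 : (3 / 2 <= log2 n)%R.
  have l9 : (log2 (2 ^ 3) <= log2 (3 ^ 2))%R by apply: log2_le; lra.
  rewrite !log2_pow ?log2_2 /= in l9; try lra.
  have := @log2_le 3 n; lra.
split=> //.
have l9 : (log2 (2 ^ 1) <= log2 ((3 / 2) ^ 2))%R by apply: log2_le; lra.
rewrite !log2_pow ?log2_2 /= in l9; try lra.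
have := @log2_le (3 / 2) (log2 n); lra.
Qed.

(* [q] measures the degree in base [2^r] up to the factor [2^a]; the choice
   r ~ sqrt (D l) balances the loss [q a] against the loss [2 r]. *)
Lemma exponent_bound (D l a y r q : R) :
  (1 <= D -> 1 / 2 <= l -> 0 <= y -> y * y = D * l -> y <= r <= y + 1 ->
   0 <= q -> 0 <= a <= 11 * l -> D - 1 <= q * (a + r) ->
   D - 18 * y <= r * (q - 2))%R.
Proof.
move=> D1 l0 y0 yy yr q0 al Dq.
have y1 : (7 / 10 <= y)%R by nra.
(* Here [2 r <= 2 y + 2] and [3 <= 5 y], whence 18 = 11 + 2 + 5. *)
suff : (D - 1 - 11 * y <= r * q)%R by nra.
(* Failure would give [q y <= D], hence [q l <= y] and [q a <= 11 y], against the lower bound on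
   [q (a + r)]. *)
have [//|lt] := Rle_or_lt (D - 1 - 11 * y) (r * q).
have qy : (q * y <= D)%R by nra.
have ql : (q * l <= y)%R.
  apply: (Rmult_le_reg_r y); first lra.
  nra.
nra.
Qed.

Theorem theorem1p2 :
  exists C : R, (0 < C)%R /\
    forall (T : finType) (e : rel T),
      simple_graph e ->
      (2 <= avg_degree e)%R ->
      (avg_degree e / Rpower 2 (C * sqrt (log2 (avg_degree e) * log2 (log2 (INR #|T|))))
         <= INR (altitude e))%R.
Proof.
exists 18%R; split; first lra.
move=> T e simple d2.
set d := avg_degree e in d2 *; set n := #|T|; set E := #|edges e|.
(* With no vertices there are no edges, so the quotient is 0 whatever division by 0 means. *)
have n0 : 0 < n.
  rewrite lt0n; apply/eqP => n0; move: d2; rewrite /d /avg_degree -/n n0.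
  have -> : #|edges e| = 0.
    apply/eqP; rewrite -leqn0; have := npairs_edges simple; have := npairs_le simple.
    by rewrite -/n n0; lia.
  rewrite /Rdiv Rmult_0_r Rmult_0_l; lra.
have nR : (0 < INR n)%R by apply/lt_0_INR/ltP.
have dn : (d * INR n = 2 * INR E)%R.
  by rewrite /d /avg_degree -/n -/E; field; lra.
have nE : n <= E by apply/leP/INR_le; nra.
have n3 : (3 <= INR n)%R.
  by have /leP/le_INR := card_gt2_edges simple nE n0; rewrite -/n /=; lra.
have [ln1 ll1] := log2_loglog_ge n3.
set ll := log2 (log2 (INR n)) in ll1 *.
have D1 : (1 <= log2 d)%R by rewrite -log2_2; apply: log2_le; lra.
set y := sqrt _.
have yy : (y * y = log2 d * ll)%R by apply: sqrt_sqrt; nra.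
have y0 : (0 <= y)%R by apply: sqrt_pos.
have [r [r0 yr]] : exists r : nat, 0 < r /\ (y <= INR r <= y + 1)%R.
  have [up1 up2] := archimed y.
  have up0 : (0 < up y)%Z by apply: lt_IZR; lra.
  have [k upk] := IZN _ (Z.lt_le_incl _ _ up0).
  rewrite upk -INR_IZR_INZ in up0 up1 up2.
  by exists k; split; [lia|lra].
have m1 : 1 < expn 2 r by rewrite -{1}(expn0 2) ltn_exp2l.
have [q [Eq qf]] := altitude_tradeoff simple m1 (leq_trans n0 nE).
set M := (trunc_log 2 #|T|).+1 in Eq.
have pow2 k : INR (expn 2 k) = (2 ^ k)%R by rewrite expn_pow pow_INR.
have ML : (INR M <= 2 * log2 (INR n))%R.
  have /leP/le_INR := trunc_logP (isT : 1 < 2) n0; rewrite pow2 => le.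
  have := log2_le (pow_lt 2 _ Rlt_0_2) le; rewrite log2_pow ?log2_2; last lra.
  rewrite /M S_INR -/n; lra.
have M1 : (1 <= INR M)%R by rewrite /M S_INR; have := pos_INR (trunc_log 2 #|T|); lra.
set a := log2 (10 * INR M).
(* [10 * M] is at most [2 ^ 5] times log n, and [5 <= 10 * ll]. *)
have a0 : (0 <= a <= 11 * ll)%R.
  split.
    by rewrite (_ : 0 = log2 1)%R; [apply: log2_le; lra|rewrite /log2 ln_1; lra].
  have : (a <= log2 (2 ^ 5 * log2 (INR n)))%R by apply: log2_le; lra.
  rewrite log2_mult ?log2_pow ?log2_2 -/ll /=; lra.
have Dq : (log2 d - 1 <= INR q * (a + INR r))%R.
  have dle : (d <= 2 * (10 * INR M * 2 ^ r) ^ q)%R.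
    apply: (Rmult_le_reg_r (INR n)) => //.
    move/leP/le_INR: Eq; rewrite -/E -/n mult_INR expn_pow pow_INR !mult_INR pow2.
    rewrite (_ : INR 10 = 10%R); last by rewrite INR_IZR_INZ.
    lra.
  have p2 : (0 < 2 ^ r)%R by apply: pow_lt; lra.
  have b0 : (0 < 10 * INR M * 2 ^ r)%R by apply: Rmult_lt_0_compat; lra.
  have pq := pow_lt _ q b0.
  have := log2_le (Rlt_le_trans _ _ _ Rlt_0_2 d2) dle.
  rewrite log2_mult; [|lra|exact: pq].
  rewrite log2_pow // log2_mult; [|lra|exact: p2].
  by rewrite log2_pow ?log2_2 -/a; lra.
have := exponent_bound D1 ll1 y0 yy yr (pos_INR q) a0 Dq => bound.
have d0 : (0 < d)%R by lra.
rewrite -{1}(Rpower_log2 d0) /Rdiv -Rpower_Ropp -Rpower_plus.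
apply: Rle_trans (_ : (Rpower 2 (INR (r * (q - 2))) <= _)%R); last first.
  rewrite Rpower_pow; last lra.
  by rewrite -pow2 expnM; apply/le_INR/leP.
apply: Rle_Rpower; first lra.
rewrite mult_INR.
(* Truncated subtraction errs in the favourable direction. *)
have : (INR q - 2 <= INR (q - 2))%R.
  have /leP/le_INR : q <= q - 2 + 2 by lia.
  by rewrite plus_INR /=; lra.
have := pos_INR r; nra.
Qed.
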